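(* The folded cubes $\mathrm{FQ}_1$ and $\mathrm{FQ}_2$ are $[1,0,4]$-cycle regular. The folded cube $\mathrm{FQ}_4$ is $[1,9,4]$-cycle regular. For every integer $n\ge 1$ with $n\notin\{1,2,4\}$, the folded cube $\mathrm{FQ}_n$ is $[1,n-1,4]$-cycle regular.
   Context: For $n\ge 1$, the folded cube $\mathrm{FQ}_n$ is the simple graph with vertex set $\{0,1\}^{n-1}$ in which two distinct vertices are adjacent if and only if they differ in exactly one coordinate or one is the coordinatewise complement of the other (equivalently, $\mathrm{FQ}_n$ is obtained from the $n$-dimensional hypercube by identifying antipodal vertices). For integers $l,\lambda,m$, a simple graph is $[l,\lambda,m]$-cycle regular if every path on $l+1$ vertices belongs to exactly $\lambda$ different cycles of length $m$. *)

(* Defs.v *)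
From mathcomp Require Import all_boot.

Set Implicit Arguments.
Unset Strict Implicit.
Unset Printing Implicit Defensive.

Record sgraph := SGraph {
  vertex :> finType;
  adj : rel vertex;
  adj_sym : symmetric adj;
  adj_irrefl : irreflexive adj
}.

Section Subgraphs.
Variable G : sgraph.

(* A subgraph is a pair (vertex set, edge set), an edge being a two-element set
   of vertices. Paths and cycles are identified when they are equal as
   subgraphs, whatever starting vertex or orientation was used to list them. *)
Definition subgraph : Type := ({set G} * {set {set G}})%type.

Definition sub_subgraph (P C : subgraph) : bool :=
  (P.1 \subset C.1) && (P.2 \subset C.2).

Definition path_subgraph (p : seq G) : subgraph :=
  ([set x in p], [set [set z.1; z.2] | z in zip p (behead p)]).

Definition cycle_subgraph (c : seq G) : subgraph :=
  ([set x in c], [set [set x; next c x] | x in c]).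

Definition is_path (k : nat) (P : subgraph) : bool :=
  [exists p : k.-tuple G,
     [&& uniq p, sorted (@adj G) p & P == path_subgraph p]].

(* The bound 2 < m excludes the degenerate closed walks x, x and x, y, x. *)
Definition is_cycle (m : nat) (C : subgraph) : bool :=
  (2 < m) &&
  [exists c : m.-tuple G,
     [&& uniq c, cycle (@adj G) c & C == cycle_subgraph c]].

End Subgraphs.

Definition cycle_regular (G : sgraph) (l lambda m : nat) : Prop :=
  forall P : subgraph G, is_path l.+1 P ->
    #|[set C : {set G} * {set {set G}} | is_cycle m C & sub_subgraph P C]|
      = lambda.

Section FoldedCube.
Variable n : nat.

Definition fq_vertex : finType := {ffun 'I_n.-1 -> bool}.

Definition fq_adj : rel fq_vertex := fun x y =>
  (x != y) &&
  ((#|[set i | x i != y i]| == 1) || (y == [ffun i => ~~ x i])).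

Lemma fq_adj_sym : symmetric fq_adj.
Proof.
move=> x y; rewrite /fq_adj eq_sym; congr (_ && (_ || _)).
  by congr (_ == _); apply: eq_card => i; rewrite !inE eq_sym.
by apply/eqP/eqP => ->; apply/ffunP => i; rewrite !ffunE negbK.
Qed.

Lemma fq_adj_irrefl : irreflexive fq_adj.
Proof. by move=> x; rewrite /fq_adj eqxx. Qed.

(* Meaningful for 0 < n only: n.-1 truncates, so FQ 0 coincides with FQ 1. *)
Definition FQ : sgraph := SGraph fq_adj_sym fq_adj_irrefl.

End FoldedCube.

(* Main.v *)
Require Import Defs.
From mathcomp Require Import all_boot.

Set Implicit Arguments.
Unset Strict Implicit.
Unset Printing Implicit Defensive.

(** [FQ n] is the Cayley graph of [F_2^(n-1)] for the generators
    [e_1, ..., e_(n-1)] and [e_1 + ... + e_(n-1)]. In any graph the 4-cycles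
    through an edge [xy] correspond to the pairs [(a, b)] with [a] adjacent to
    [x], [b] adjacent to [y] and [a] adjacent to [b] ([a != y], [b != x]). With
    [y = x + s], [a = x + t] and [b = y + r], the last adjacency asks that
    [s + t + r] be a generator. As the only relation between the [n] generators
    is that their total sum vanishes, this forces [t = r] when [n != 4], whereas
    for [n = 4] any [t] and [r] distinct from [s] will do. *)

(** * 4-cycles through an edge of an arbitrary graph *)

Section FourCycles.
Variable G : sgraph.
Implicit Types (x y a b c d : G) (C : subgraph G).

Lemma set2_eq {T : finType} {x y a b : T} :
  [set x; y] = [set a; b] -> (x = a /\ y = b) \/ (x = b /\ y = a).
Proof.
move=> /setP e.
have := e x; have := e y; have := e a; have := e b; rewrite !inE !eqxx ?orbT /=.
move=> hb ha /esym hy /esym hx.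
case/orP: hx => /eqP hx; case/orP: hy => /eqP hy; subst; auto.
- by move: hb; rewrite orbb => /eqP ->; auto.
- by move: ha; rewrite orbb => /eqP ->; auto.
Qed.

(** Free of [next], so that the symmetries of the square become plain identities between sets. *)
Definition cycle4 a b c d : subgraph G :=
  ([set a; b; c; d], [set [set a; b]; [set b; c]; [set c; d]; [set d; a]]).

Lemma cycle4E a b c d :
  uniq [:: a; b; c; d] -> cycle_subgraph [:: a; b; c; d] = cycle4 a b c d.
Proof.
rewrite /= !inE !negb_or andbT => /and3P[/and3P[ab ac ad] /andP[bc bd] cd].
rewrite /cycle_subgraph /cycle4; congr (_, _).
  by apply/setP => z; rewrite !inE -!orbA.
have na : next [:: a; b; c; d] a = b by rewrite /= eqxx.
have nb : next [:: a; b; c; d] b = c by rewrite /= eqxx eq_sym (negbTE ab).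
have nc : next [:: a; b; c; d] c = d.
  by rewrite /= eqxx !(eq_sym c) (negbTE ac) (negbTE bc).
have nd : next [:: a; b; c; d] d = a.
  by rewrite /= eqxx !(eq_sym d) (negbTE ad) (negbTE bd) (negbTE cd).
apply/setP => E; rewrite !inE; apply/imsetP/idP.
  move=> [z]; rewrite !inE => /or4P[] /eqP -> ->;
  by rewrite ?na ?nb ?nc ?nd eqxx ?orbT.
by rewrite -!orbA => /or4P[] /eqP ->;
  [exists a|exists b|exists c|exists d]; rewrite ?na ?nb ?nc ?nd // !inE eqxx ?orbT.
Qed.

Lemma cycle4_rot a b c d : cycle4 a b c d = cycle4 b c d a.
Proof.
by congr (_, _); apply/setP => z; rewrite !inE -!orbA [in LHS]orbC -!orbA.
Qed.

(** Together with [cycle4_rot] this generates the dihedral group: any edge of the cycle can be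
    listed first, in either direction. *)
Lemma cycle4_flip a b c d : cycle4 a b c d = cycle4 b a d c.
Proof.
rewrite /cycle4 [[set b; a]]setUC [[set a; d]]setUC [[set d; c]]setUC [[set c; b]]setUC.
congr (_, _); apply/setP => z; rewrite !inE.
  by case: (z == a); case: (z == b); case: (z == c); case: (z == d).
by case: (z == [set a; b]); case: (z == [set b; c]); case: (z == [set c; d]);
   case: (z == [set d; a]).
Qed.

Lemma is_cycle4P C :
  reflect (exists a b c d, [/\ uniq [:: a; b; c; d],
             [&& adj a b, adj b c, adj c d & adj d a] & C = cycle4 a b c d])
          (is_cycle 4 C).
Proof.
apply: (iffP existsP) => [[[[|a [|b [|c [|d [|? ?]]]]] // i]] |].
  case/and3P=> /= u; rewrite andbT => e /eqP ->.
  by exists a, b, c, d; rewrite cycle4E.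
move=> [a [b [c [d [u e ->]]]]]; exists [tuple a; b; c; d].
by rewrite u /= andbT e /= cycle4E ?eqxx.
Qed.

(** The vertex condition comes for free, since both endpoints of each edge of the cycle are among
    its vertices. *)
Lemma sub_edge_cycle4 x y a b c d :
  sub_subgraph (path_subgraph [:: x; y]) (cycle4 a b c d) =
  ([set x; y] \in (cycle4 a b c d).2).
Proof.
have -> : path_subgraph [:: x; y] = ([set x; y], [set [set x; y]]).
  congr (_, _); first by apply/setP => z; rewrite !inE.
  apply/setP => E; rewrite inE; apply/imsetP/eqP => [[z]|->].
    by rewrite inE => /eqP -> ->.
  by exists (x, y); rewrite ?inE.
rewrite /sub_subgraph /= sub1set; apply: andb_idl => e.
apply/subsetP => z zxy; move: e; rewrite !inE.
by rewrite -!orbA => /or4P[] /eqP E; move: zxy; rewrite E !inE;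
   case/orP => ->; rewrite ?orbT.
Qed.

Lemma is_cycle4_edgeP x y C : adj x y ->
  reflect (exists a b, [/\ [&& adj x a, adj y b & adj a b], a != y, b != x
             & C = cycle4 x y b a])
          (is_cycle 4 C && sub_subgraph (path_subgraph [:: x; y]) C).
Proof.
move=> xy; apply: (iffP andP) => [[/is_cycle4P[a [b [c [d [u e ->]]]]]] |].
  rewrite sub_edge_cycle4 /= !inE -!orbA.
  (* The case where the given edge is the first one of the cycle; the other three edges reduce to it
     by rotation. *)
  have first a' b' c' d' : uniq [:: a'; b'; c'; d'] ->
      [&& adj a' b', adj b' c', adj c' d' & adj d' a'] ->
      [set x; y] = [set a'; b'] ->
      exists a b, [/\ [&& adj x a, adj y b & adj a b], a != y, b != x
             & cycle4 a' b' c' d' = cycle4 x y b a].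
    rewrite /= !inE !negb_or andbT.
    move=> /and3P[/and3P[ab ac ad] /andP[bc bd] cd] /and4P[eab ebc ecd eda].
    case/set2_eq => -[xE yE]; subst a' b'.
      exists d', c'; rewrite [adj x _]adj_sym eda ebc adj_sym ecd.
      by rewrite eq_sym bd eq_sym ac.
    exists c', d'; rewrite ebc adj_sym eda ecd eq_sym ac eq_sym bd.
    by rewrite cycle4_flip.
  have rot a' b' c' d' : uniq [:: a'; b'; c'; d'] -> uniq [:: b'; c'; d'; a'].
    by rewrite -(rot_uniq 1).
  have rote a' b' c' d' : [&& adj a' b', adj b' c', adj c' d' & adj d' a'] ->
       [&& adj b' c', adj c' d', adj d' a' & adj a' b'].
    by move=> /and4P[-> -> -> ->].
  case/or4P => /eqP E.
  - exact: first.
  - by rewrite cycle4_rot; apply: first; auto.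
  - by rewrite 2!cycle4_rot; apply: first; auto.
  - by rewrite 3!cycle4_rot; apply: first; auto.
move=> [a [b [/and3P[xa yb ab] ay bx ->]]].
rewrite sub_edge_cycle4 !inE eqxx; split=> //; apply/is_cycle4P.
(* Of the six inequalities in [uniq], four hold along edges by irreflexivity; the two diagonals are
   [a != y] and [b != x]. *)
have ne (z t : G) : adj z t -> z != t by apply: contraTneq => ->; rewrite adj_irrefl.
exists x, y, b, a; split=> //.
  rewrite /= !inE !negb_or (ne _ _ xy) (ne _ _ xa) (ne _ _ yb) [x == b]eq_sym bx.
  by rewrite [y == a]eq_sym ay [b == a]eq_sym (ne _ _ ab).
by rewrite xy yb adj_sym ab adj_sym xa.
Qed.

(** The pair can be read off from the cycle: besides the edge [[set x; y]], exactly one edge of the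
    cycle meets [x], which gives [a], and exactly one meets [y], which gives [b]. *)
Lemma card_cycle4_edge x y : adj x y ->
  #|[set C : {set G} * {set {set G}} |
      is_cycle 4 C & sub_subgraph (path_subgraph [:: x; y]) C]| =
  #|[set ab : G * G | [&& adj x ab.1, adj y ab.2 & adj ab.1 ab.2]
                      && (ab.1 != y) && (ab.2 != x)]|.
Proof.
move=> xy; set A := [set ab : G * G | _].
have ne (z t : G) : adj z t -> z != t by apply: contraTneq => ->; rewrite adj_irrefl.
rewrite -(@card_in_imset _ _ (fun ab => cycle4 x y ab.2 ab.1) (mem A)).
  apply: eq_card => C; rewrite inE; apply/is_cycle4_edgeP/imsetP => //.
    by move=> [a [b [e ay bx ->]]]; exists (a, b); rewrite ?inE /= ?e ?ay ?bx.
  move=> [[a b]]; rewrite inE /= => /andP[/andP[e ay] bx] ->.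
  by exists a, b.
move=> [a b] [a' b']; rewrite !inE /=.
move=> /andP[/andP[/and3P[xa yb ab] ay] bx].
move=> /andP[/andP[/and3P[xa' yb' ab'] ay'] bx'] [_ E].
have [nxy nxa' nyb'] := And3 (ne _ _ xy) (ne _ _ xa') (ne _ _ yb').
congr (_, _).
  have : [set a; x] \in [set [set x; y]; [set y; b']; [set b'; a']; [set a'; x]].
    by rewrite -E !inE eqxx ?orbT.
  rewrite !inE -!orbA => /or4P[] /eqP /set2_eq[] [h1 h2]; subst => //;
  by move: ay bx ay' bx' nxy nxa' nyb'; rewrite ?eqxx.
have : [set y; b] \in [set [set x; y]; [set y; b']; [set b'; a']; [set a'; x]].
  by rewrite -E !inE eqxx ?orbT.
rewrite !inE -!orbA => /or4P[] /eqP /set2_eq[] [h1 h2]; subst => //;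
by move: ay bx ay' bx' nxy nxa' nyb'; rewrite ?eqxx.
Qed.

Lemma cycle_regular_edge l :
  (forall x y, adj x y ->
    #|[set ab : G * G | [&& adj x ab.1, adj y ab.2 & adj ab.1 ab.2]
                        && (ab.1 != y) && (ab.2 != x)]| = l) ->
  cycle_regular G 1 l 4.
Proof.
move=> H P /existsP[[[|x [|y [|? ?]]] // i]] /and3P[/= _].
by rewrite andbT => xy /eqP ->; rewrite card_cycle4_edge ?H.
Qed.

(** A 4-cycle needs four distinct vertices. *)
Lemma cycle_regular_small l : #|G| < 4 -> cycle_regular G l 0 4.
Proof.
move=> G4 P _; apply/eqP; rewrite cards_eq0; apply/eqP/setP => C; rewrite !inE.
apply/negP => /andP[/is_cycle4P[a [b [c [d [u _ _]]]]] _].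
by move: (max_card [in [:: a; b; c; d]]); rewrite (card_uniqP u) leqNgt G4.
Qed.

End FourCycles.

(** * The folded cube as a Cayley graph *)

Section FoldedCube.
Variable n : nat.
Local Notation dim := n.-1.
Implicit Types (x y : FQ n) (s t r q : option 'I_dim).

(** The generators as vectors over F_2: [Some j] is the basis vector e_j and [None] the all-ones
    vector, so [option 'I_dim] indexes all of them. *)
Definition gen s (i : 'I_dim) : bool := if s is Some j then j == i else true.

Definition step x s : FQ n := [ffun i => x i (+) gen s i].

Lemma fq_adjP x y : 1 < n -> reflect (exists s, y = step x s) (adj x y).
Proof.
move=> n_gt1; have i0 : 'I_dim by case: n n_gt1 => [|[|m]] // _; exact: ord0.
apply: (iffP idP) => [/andP[_ /orP[/cards1P[j /setP e]|/eqP ->]]|[s ->]].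
- exists (Some j); apply/ffunP => i; have := e i; rewrite !inE !ffunE /= eq_sym.
  by rewrite (eq_sym j) => <-; case: (x i) (y i) => [] [].
- by exists None; apply/ffunP => i; rewrite !ffunE /= addbT.
apply/andP; split.
  (* A coordinate that the step flips: [j] itself for [Some j], and any one, here [i0], for
     [None]. *)
  apply/eqP => /ffunP e; move: (e (odflt i0 s)); rewrite ffunE.
  by case: s e => [j|] _ /=; rewrite ?eqxx; case: (x _).
case: s => [j|]; last first.
  by apply/orP; right; apply/eqP/ffunP => i; rewrite !ffunE addbT.
apply/orP; left; apply/cards1P; exists j; apply/setP => i; rewrite !inE ffunE /=.
by rewrite [i == j]eq_sym; case: (x i); case: (j == i).
Qed.

(** A second coordinate separates a basis vector from the all-ones vector; with a single coordinate
    the two coincide. *)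
Lemma gen_inj : 2 < n -> forall s t, gen s =1 gen t -> s = t.
Proof.
move=> n_gt2; have other (i : 'I_dim) : exists j, i != j.
  apply/existsP; apply: contraLR n_gt2; rewrite negb_exists => /forallP h.
  rewrite -leqNgt; suff : dim <= 1 by case: (n) => [|[]].
  rewrite -[X in X <= _]card_ord -(cards1 i) -cardsT subset_leq_card //.
  by apply/subsetP => j _; rewrite inE eq_sym; move: (h j); rewrite negbK.
move=> [i|] [j|] // e.
- by move: (e j); rewrite /= eqxx => /eqP ->.
- by have [j ij] := other i; move: (e j); rewrite /= (negbTE ij).
- by have [i ij] := other j; move: (e i); rewrite /= (negbTE ij).
Qed.

Lemma step_inj x : 2 < n -> injective (step x).
Proof.
move=> n_gt2 s t /ffunP e; apply: gen_inj => // i; have := e i.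
by rewrite !ffunE => /addbI.
Qed.

Lemma stepK x s : step (step x s) s = x.
Proof. by apply/ffunP => i; rewrite !ffunE addbK. Qed.

Lemma stepC x s t : step (step x s) t = step (step x t) s.
Proof. by apply/ffunP => i; rewrite !ffunE addbAC. Qed.

(** Four generators summing to zero must cancel in pairs, unless they are all n generators, which
    requires n = 4. As [s] differs from [t] and [r], it cancels with [q], leaving [t = r]. *)
Lemma gen_relation s t r q : n != 4 ->
  (forall i, gen s i (+) gen t i (+) gen r i (+) gen q i = false) ->
  s != t -> s != r -> t = r.
Proof.
move=> n4.
(* Three distinct coordinates exhaust ['I_dim] only when n - 1 = 3. *)
have outside (a b c : 'I_dim) : a != b -> a != c -> b != c ->
    exists i, [/\ a != i, b != i & c != i].
  move=> ab ac bc; suff /existsP[i] : [exists i, i \notin [set a; b; c]].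
    rewrite !inE !negb_or => /andP[/andP[ia ib] ic].
    by exists i; rewrite !(eq_sym _ i).
  apply: contraR n4; rewrite negb_exists => /forallP h.
  have : #|[set a; b; c]| = 3.
    by rewrite setUC cardsU1 cards2 !inE negb_or ab !(eq_sym c) ac bc.
  have -> : [set a; b; c] = setT.
    by apply/setP => i; have := h i; rewrite negbK in_setT => ->.
  by rewrite cardsT card_ord; case: (n) => [|m] //= ->.
(* Suppose [s], [t], [r] are pairwise distinct, so at most one of them is [None]. With exactly one
   [None] among the four, the basis vectors are three distinct ones, and the sum is 1 at a
   coordinate outside them. With none or two, the sum is 1 at a coordinate of one of the basis
   vectors. *)
move=> e st sr; apply/eqP; apply/negP => /negP tr.
have some_eq (a b : 'I_dim) : (Some a == Some b) = (a == b) by [].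
move: s t r q e st sr tr.
move=> [a|] [b|] [c|] [d|] //= e; rewrite ?some_eq => h1 h2 h3.
- have := e a; have := e b; rewrite !eqxx (eq_sym b a) (eq_sym c a) (eq_sym c b).
  rewrite (negbTE h1) (negbTE h2) (negbTE h3) /=.
  by case: eqP => // ->; rewrite (eq_sym b a) (negbTE h1).
- have [i [ai bi ci]] := outside _ _ _ h1 h2 h3.
  by move: (e i); rewrite (negbTE ai) (negbTE bi) (negbTE ci).
- have := e a; have := e b; rewrite !eqxx (eq_sym b a) (negbTE h1) /=.
  case: eqP => // /eqP db; case: eqP => // /eqP da _ _.
  rewrite eq_sym in da; rewrite eq_sym in db.
  have [i [ai bi di]] := outside _ _ _ h1 da db.
  by move: (e i); rewrite (negbTE ai) (negbTE bi) (negbTE di).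
- by move: (e a); rewrite /= eqxx eq_sym (negbTE h1).
- have := e a; have := e c; rewrite !eqxx (eq_sym c a) (negbTE h2) /=.
  case: eqP => // /eqP dc; case: eqP => // /eqP da _ _.
  rewrite eq_sym in da; rewrite eq_sym in dc.
  have [i [ai ci di]] := outside _ _ _ h2 da dc.
  by move: (e i); rewrite (negbTE ai) (negbTE ci) (negbTE di).
- by move: (e a); rewrite /= eqxx eq_sym (negbTE h2).
- have := e b; have := e c; rewrite !eqxx (eq_sym c b) (negbTE h3) /=.
  case: eqP => // /eqP dc; case: eqP => // /eqP db _ _.
  rewrite eq_sym in db; rewrite eq_sym in dc.
  have [i [bi ci di]] := outside _ _ _ h3 db dc.
  by move: (e i); rewrite (negbTE bi) (negbTE ci) (negbTE di).
- by move: (e b); rewrite /= eqxx eq_sym (negbTE h3).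
Qed.

Lemma card_fq_cycle4 x s : 2 < n ->
  #|[set ab : FQ n * FQ n |
      [&& adj x ab.1, adj (step x s) ab.2 & adj ab.1 ab.2]
      && (ab.1 != step x s) && (ab.2 != x)]| =
  #|[set tr : option 'I_dim * option 'I_dim |
      [&& tr.1 != s, tr.2 != s & adj (step x tr.1) (step (step x s) tr.2)]]|.
Proof.
move=> n_gt2; have n_gt1 := ltnW n_gt2; set Q := [set tr | _].
pose f (tr : option 'I_dim * option 'I_dim) := (step x tr.1, step (step x s) tr.2).
have f_inj : injective f.
  by move=> [t r] [t' r'] [/(step_inj n_gt2) -> /(step_inj n_gt2) ->].
rewrite -(card_imset _ f_inj); apply: eq_card => -[a b]; rewrite inE /=.
apply/idP/imsetP => [/andP[/andP[/and3P[]]] | [[t r]]].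
  move=> /(fq_adjP _ _ n_gt1)[t ->] /(fq_adjP _ _ n_gt1)[r ->] e ts rs.
  exists (t, r) => //; rewrite inE /= e andbT; apply/andP; split.
    by apply: contraNneq ts => ->.
  by apply: contraNneq rs => ->; rewrite stepK.
rewrite inE /= => /and3P[ts rs e] [-> ->]; rewrite e andbT (inj_eq (step_inj n_gt2)) ts.
(* Writing [x] as [step (step x s) s] turns [b != x] into [r != s]. *)
rewrite -[X in _ != X](stepK x s) (inj_eq (step_inj n_gt2)) rs !andbT.
by apply/andP; split; apply/fq_adjP => //; [exists t|exists r].
Qed.

Lemma fq_cycle_regular : 2 < n -> n != 4 -> cycle_regular (FQ n) 1 (n - 1) 4.
Proof.
move=> n_gt2 n4; apply: cycle_regular_edge => x y.
have n_gt1 := ltnW n_gt2; move=> /(fq_adjP _ _ n_gt1)[s ->].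
rewrite card_fq_cycle4 //.
have -> : n - 1 = #|[set~ s]|.
  by rewrite cardsC1 card_option card_ord subn1.
(* The admissible pairs form the diagonal over the n - 1 generators other than [s]. *)
have diag_inj : injective (fun t => (t, t)) by move=> t t' [].
rewrite -(card_imset _ diag_inj).
apply: eq_card => -[t r]; rewrite inE /=.
apply/and3P/imsetP => [[ts rs /(fq_adjP _ _ n_gt1)[q /ffunP e]]|[t' t's [-> ->]]].
  exists t; first by rewrite !inE.
  congr (_, _); apply/esym/(@gen_relation s t r q) => //; rewrite 1?eq_sym //.
  move=> i; have := e i; rewrite !ffunE.
  by case: (x i) (gen s i) (gen t i) (gen r i) (gen q i) => [] [] [] [] [].
(* The side of the 4-cycle opposite to the given edge has the same direction [s]. *)
rewrite !inE in t's; split=> //; apply/fq_adjP => //; exists s.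
by rewrite stepC.
Qed.

End FoldedCube.

(** * The exceptional case n = 4 *)

(** A vector of odd weight in F_2^3 has weight 1 or 3, hence is a basis vector or the all-ones
    vector. *)
Lemma odd_gen3 (d : 'I_3 -> bool) :
  \big[addb/false]_i d i -> exists s : option 'I_4.-1, d =1 gen s.
Proof.
rewrite !big_ord_recl big_ord0 addbF.
set i0 : 'I_3 := ord0; set i1 : 'I_3 := lift ord0 ord0.
set i2 : 'I_3 := lift ord0 (lift ord0 ord0).
have all3 (P : 'I_3 -> Prop) : P i0 -> P i1 -> P i2 -> forall i, P i.
  move=> P0 P1 P2 [[|[|[|//]]] lti].
  - by rewrite (_ : Ordinal lti = i0) //; apply: val_inj.
  - by rewrite (_ : Ordinal lti = i1) //; apply: val_inj.
  - by rewrite (_ : Ordinal lti = i2) //; apply: val_inj.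
case E0: (d i0); case E1: (d i1); case E2: (d i2) => //= _.
- by exists None; apply: all3.
- by exists (Some i0); apply: all3.
- by exists (Some i1); apply: all3.
- by exists (Some i2); apply: all3.
Qed.

(** The weight of a generator is 1 or [n.-1]. *)
Lemma odd_gen n (s : option 'I_n.-1) :
  odd n.-1 -> \big[addb/false]_i gen s i.
Proof.
case: s => [j|] on.
  rewrite (bigD1 j) //= eqxx big1 // => i ij.
  by rewrite eq_sym (negbTE ij).
by rewrite big_const card_ord; elim: n.-1 on => //= k; case: odd.
Qed.

Lemma fq4_cycle_regular : cycle_regular (FQ 4) 1 9 4.
Proof.
apply: cycle_regular_edge => x y /fq_adjP[//|s ->].
rewrite card_fq_cycle4 //.
(* Each of [t] and [r] ranges freely over the three generators other than [s]. *)
have -> : 9 = #|setX [set~ s] [set~ s]|.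
  by rewrite cardsX cardsC1 card_option card_ord.
apply: eq_card => -[t r]; rewrite !inE /=; case: (t != s) (r != s) => [] [] //=.
apply/fq_adjP => //.
(* A sum of three vectors of odd weight has odd weight, so it is again a generator. *)
have [q e] : exists q : option 'I_4.-1,
    (fun i => gen s i (+) gen t i (+) gen r i) =1 gen q.
  have odd_gen4 u : \big[addb/false]_(i < 3) @gen 4 u i by exact: (@odd_gen 4).
  by apply: odd_gen3; rewrite !big_split /= !odd_gen4.
exists q; apply/ffunP => i; rewrite !ffunE -e.
by case: (x i) (gen s i) (gen t i) (gen r i) => [] [] [] [].
Qed.

Theorem theorem5 :
  cycle_regular (FQ 1) 1 0 4 /\
  cycle_regular (FQ 2) 1 0 4 /\
  cycle_regular (FQ 4) 1 9 4 /\
  (forall n : nat, 1 <= n -> n \notin [:: 1; 2; 4] ->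
     cycle_regular (FQ n) 1 (n - 1) 4).
Proof.
(* [FQ 1] has 2^0 vertices and [FQ 2] has 2^1, too few for a 4-cycle. *)
split; first by apply: cycle_regular_small; rewrite card_ffun card_bool card_ord.
split; first by apply: cycle_regular_small; rewrite card_ffun card_bool card_ord.
split; first exact: fq4_cycle_regular.
move=> n n_gt0; rewrite !inE !negb_or => /and3P[n1 n2 n4].
by apply: fq_cycle_regular; case: n n_gt0 n1 n2 n4 => [|[|[|]]].
Qed.
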